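(* For every positive integer $n$, the vertices of the polytope $\mathrm{TSSCPP}(n)$ are exactly the $n\times n$ magog matrices.
   Context: An $n\times n$ magog matrix is an $n\times n$ matrix $A=(a_{ij})$ with entries in $\{0,1,-1\}$ such that all row sums and all column sums equal $1$, $0\le \sum_{i'=1}^{i}a_{i'j}\le 1$ for all $1\le i,j\le n$, $\sum_{j'=1}^{j}a_{ij'}\ge 0$ for all $1\le i,j\le n$, and for all $1\le i\le n-2$, $1\le j\le n-2$, $$\sum_{j'=1}^{j}a_{i+1,j'}+\sum_{i'=1}^{i+1}a_{i',j+1}-\sum_{i'=1}^{i}a_{i'j}\ge 0.$$ $\mathrm{TSSCPP}(n)\subseteq\mathbb{R}^{n\times n}$ is the convex hull of all $n\times n$ magog matrices. *)

(* Defs.v *)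
From HB Require Import structures.
From mathcomp Require Import all_boot all_order all_algebra.
From mathcomp Require Import boolp classical_sets reals convex.

Set Implicit Arguments.
Unset Strict Implicit.
Unset Printing Implicit Defensive.

Import Order.TTheory GRing.Theory Num.Theory.
Local Open Scope classical_set_scope.
Local Open Scope ring_scope.

Section Polytope.
Variables (R : realType) (E : lmodType R).
Implicit Types (S P F : set E) (v : E).

Definition convex_hull S : set E := smallest (@convex_set R E) S.

(* The inequality f x <= b is valid on P, and F is where it is tight. *)
Definition is_face P F : Prop :=
  exists (f : {scalar E}) (b : R),
    (forall x, P x -> f x <= b) /\ F = P `&` [set x | f x = b].

Definition vertices P : set E := [set v | is_face P [set v]].

End Polytope.

Section Magog.
Variables (R : realType) (n : nat).
Implicit Types (A : 'M[R]_n) (i j : 'I_n).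

(* Partial sums include the entry (i, j) itself. *)
Definition row_psum A i j : R := \sum_(j' < n | (j' <= j)%N) A i j'.
Definition col_psum A i j : R := \sum_(i' < n | (i' <= i)%N) A i' j.

(* Indices of 'I_n start at 0.  In the last condition i1 and j1 stand for     *)
(* i + 1 and j + 1; the 1-based bounds i <= n - 2 and j <= n - 2 say that     *)
(* i1 and j1 are not the last index.                                          *)
Record is_magog A : Prop := IsMagog {
  magog_entry : forall i j, [\/ A i j = 0, A i j = 1 | A i j = -1];
  magog_row_sum : forall i, \sum_(j < n) A i j = 1;
  magog_col_sum : forall j, \sum_(i < n) A i j = 1;
  magog_col_psum : forall i j, 0 <= col_psum A i j <= 1;
  magog_row_psum : forall i j, 0 <= row_psum A i j;
  magog_mixed : forall i i1 j j1,
    i1 = i.+1 :> nat -> j1 = j.+1 :> nat -> (i1.+1 < n)%N -> (j1.+1 < n)%N ->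
    0 <= row_psum A i1 j + col_psum A i1 j1 - col_psum A i j
}.

Definition magog : set 'M[R]_n := [set A | is_magog A].

Definition TSSCPP : set 'M[R]_n := convex_hull magog.

End Magog.

Arguments magog : clear implicits.
Arguments TSSCPP : clear implicits.

(* Main.v *)
Require Import Defs.
From HB Require Import structures.
From mathcomp Require Import all_boot all_order all_algebra.
From mathcomp Require Import boolp classical_sets reals convex.
From mathcomp Require Import lra.

(** In the coordinates given by the column partial sums, a linear and injective
    change of variables, every magog matrix is a 0/1 vector, hence a vertex of
    the unit cube, which contains the whole polytope. Conversely, if the face
    [f x = b] of a convex hull is a point outside the generating set, then the
    open half-space [f x < b] contains the generators, hence the hull, hence
    that point, which is absurd. *)

Import Order.TTheory GRing.Theory Num.Theory.
Local Open Scope classical_set_scope.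
Local Open Scope ring_scope.

Section ConvexHull.
Variables (R : realType) (E : lmodType R).
Implicit Types (S : set E) (f : {scalar E}).

Lemma convex_set_lt f (b : R) : @convex_set R E [set x | f x < b].
Proof.
apply/convex_setW => x y /set_mem /= fx /set_mem /= fy k k0 k1.
apply/mem_set => /=; rewrite /conv /= linearD !linearZ /= /unstable.onem.
nra.
Qed.

Lemma convex_set_le f (b : R) : @convex_set R E [set x | f x <= b].
Proof.
apply/convex_setW => x y /set_mem /= fx /set_mem /= fy k k0 k1.
apply/mem_set => /=; rewrite /conv /= linearD !linearZ /= /unstable.onem.
nra.
Qed.

Lemma convex_hull_le f (b : R) S :
  (forall x, S x -> f x <= b) -> forall x, convex_hull S x -> f x <= b.
Proof. exact: (@smallest_sub _ _ _ _ (convex_set_le f b)). Qed.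

Lemma vertices_convex_hull S : vertices (convex_hull S) `<=` S.
Proof.
move=> v [f [b [fle vE]]].
have [Hv /= fv] : (convex_hull S `&` [set x | f x = b]) v by rewrite -vE.
apply: contrapT => NSv.
suff /(_ v Hv) : convex_hull S `<=` [set x | f x < b] by rewrite /= fv ltxx.
apply: (@smallest_sub _ _ _ _ (convex_set_lt f b)) => x Sx /=.
have Hx : convex_hull S x by exact: sub_gen_smallest Sx.
(* A generator on the hyperplane [f x = b] would lie in the face, hence be [v] itself. *)
rewrite lt_neqAle fle// andbT; apply/eqP => fx; apply: NSv.
have -> // : v = x.
by have : [set v] x by rewrite vE; split.
Qed.

Section ZeroOne.
Variables (I : finType) (c : I -> {scalar E}).

Definition weighted_form (w : I -> R) (x : E) : R := \sum_i w i * c i x.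

Fact weighted_form_linear w : linear_for *%R (weighted_form w).
Proof.
move=> a x y; rewrite /weighted_form mulr_sumr -big_split /=.
by apply: eq_bigr => i _; rewrite linearP /= mulrDr mulrCA.
Qed.

HB.instance Definition _ w :=
  GRing.isLinear.Build R E R *%R (weighted_form w) (weighted_form_linear w).

(** Over the unit cube, a 0/1 point is the only maximiser of the form with weight 1 on its
    coordinates equal to 1 and weight -1 on the others. Injectivity of the coordinates carries this
    uniqueness back to [E]. *)
Lemma vertices_convex_hull01 S :
  (forall x y, (forall i, c i x = c i y) -> x = y) ->
  (forall x i, S x -> c i x = 0 \/ c i x = 1) ->
  vertices (convex_hull S) = S.
Proof.
move=> c_inj S01; apply/seteqP; split; first exact: vertices_convex_hull.
move=> v Sv; pose w i := c i v *+ 2 - 1.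
have c_le1 i x : convex_hull S x -> c i x <= 1.
  by apply: convex_hull_le x => x Sx; have [->|->] := S01 x i Sx; lra.
have c_ge0 i x : convex_hull S x -> 0 <= c i x.
  move=> Hx; rewrite -oppr_le0.
  apply: (convex_hull_le (\- (c i) : {scalar E}) 0 S _ x Hx) => y Sy /=.
  by have [->|->] := S01 y i Sy; lra.
(* As [c i v] is 0 or 1 and [c i x] lies between them, this gap is the distance between [c i v] and
   [c i x]; it vanishes only when they agree. *)
have gap_ge0 x i : convex_hull S x -> 0 <= c i v - w i * c i x.
  move=> Hx; have := c_ge0 i x Hx; have := c_le1 i x Hx.
  by rewrite /w; have [->|->] := S01 v i Sv; lra.
exists (weighted_form w : {scalar E}), (\sum_i c i v); split=> [x Hx|] /=.
  by apply: ler_sum => i _; rewrite -subr_ge0 gap_ge0.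
apply/seteqP; split=> x /=.
  move=> ->; split; first exact: sub_gen_smallest Sv.
  by apply: eq_bigr => i _; rewrite /w; have [->|->] := S01 v i Sv; lra.
move=> [Hx fx]; apply: c_inj => i.
have gap_sum : \sum_i (c i v - w i * c i x) = 0.
  by rewrite sumrB -/(weighted_form w x) fx subrr.
have : c i v - w i * c i x = 0.
  by apply: (psumr_eq0P _ gap_sum) => // j _; exact: gap_ge0.
by rewrite /w; have [->|->] := S01 v i Sv; lra.
Qed.

End ZeroOne.
End ConvexHull.

Section Magog.
Variables (R : realType) (n : nat).
Implicit Types A B : 'M[R]_n.

Definition col_psum_form (p : 'I_n * 'I_n) A : R := col_psum A p.1 p.2.

Fact col_psum_form_linear p : linear_for *%R (col_psum_form p).
Proof.
move=> a A B; rewrite /col_psum_form /col_psum mulr_sumr -big_split /=.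
by apply: eq_bigr => i _; rewrite !mxE.
Qed.

HB.instance Definition _ p :=
  GRing.isLinear.Build R 'M[R]_n R *%R (col_psum_form p)
    (col_psum_form_linear p).

(** Strong induction on the row index: once the entries above row [i] agree, they cancel from the
    two partial sums and leave the entries in row [i]. *)
Lemma col_psum_inj A B :
  (forall i j, col_psum A i j = col_psum B i j) -> A = B.
Proof.
move=> cAB; apply/matrixP => i j.
have [m] := ubnP (nat_of_ord i); elim: m i => // m IHm i im.
have := cAB i j; rewrite /col_psum (bigD1 i) //= [in RHS](bigD1 i) //=.
rewrite (eq_bigr (B ^~ j)) => [/addIr // | i' /andP[le_i'i ne_i'i]].
by apply: IHm; rewrite (leq_trans _ (im : i <= m)%N)// ltn_neqAle le_i'i andbT.
Qed.

(** The entries are integers, so the partial sum is an integer between 0 and 1. *)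
Lemma magog_col_psum01 A i j :
  is_magog A -> col_psum A i j = 0 \/ col_psum A i j = 1.
Proof.
move=> mA; have := magog_col_psum mA i j.
have /intrP[m ->] : col_psum A i j \is a Num.int.
  rewrite rpred_sum // => i' _; have [->|->|->] := magog_entry mA i' j.
  - exact: rpred0.
  - exact: rpred1.
  - by rewrite rpredN rpred1.
rewrite ler0z lerz1; case: m => [[|[|m]]|m] //= _; by [left | right].
Qed.

End Magog.

Theorem theorem4p7 (R : realType) (n : nat) (hn : (0 < n)%N) :
  vertices (TSSCPP R n) = magog R n.
Proof.
apply: (@vertices_convex_hull01 _ _ _
  (fun p => col_psum_form R n p : {scalar 'M[R]_n})) => [A B cAB|A p mA].
  by apply: col_psum_inj => i j; exact: cAB (i, j).
exact: magog_col_psum01.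
Qed.
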